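(* Let $d\ge1$, let $\mu$ be a translation-invariant ergodic probability measure on $\{0,1\}^{\mathbb{Z}^d}$, let $\Gamma$ have law $\mu$, and suppose that $p=\mu(\Gamma(0)=1)\in(0,1)$ is the reciprocal of an integer. If $\Phi$ is a balanced allocation rule for $\mu$, then the random variable $$X=\Phi_\Gamma(0)\qquad( * )$$ is a nonrandomized extra head scheme for $\mu$. Conversely, if $X$ is a nonrandomized extra head scheme for $\mu$, then there exists a $\mu$-almost-everywhere unique balanced allocation rule $\Phi$ satisfying $( * )$ (almost surely).
   Context: For $z\in\mathbb{Z}^d$, $T^z$ acts on sites $x\in\mathbb{Z}^d$ by $T^zx=x+z$ and on configurations $\gamma\in\{0,1\}^{\mathbb{Z}^d}$ by $(T^{z}\gamma)(y)=\gamma(y-z)$. Translation-invariance and ergodicity are with respect to all $T^z$, $z\in\mathbb{Z}^d$. $\mu^*$ denotes the conditional law of $\Gamma$ given $\Gamma(0)=1$. An extra head scheme for $\mu$ is a $\mathbb{Z}^d$-valued random variable $X$ (on some joint probability space with $\Gamma$) such that $T^{-X}\Gamma$ has law $\mu^*$; it is nonrandomized if it is almost surely equal to a deterministic (measurable) function of $\Gamma$. A (discrete) balanced allocation rule for $\mu$ is a measurable map $\Phi$ which assigns to $\mu$-almost-every configuration $\gamma$ and every site $x\in\mathbb{Z}^d$ a site $\Phi_\gamma(x)\in\mathbb{Z}^d$ such that: (a) $|(\Phi_\gamma)^{-1}(y)|=p^{-1}\gamma(y)$ for $\mu$-almost-all $\gamma$ and all $y\in\mathbb{Z}^d$; (b)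 $\Phi$ is translation-invariant: if $\Phi_\gamma(x)=y$, then $\Phi_{T^z\gamma}(T^zx)=T^zy$, for all $z\in\mathbb{Z}^d$. ''$\mu$-almost-everywhere unique'' means that any two such rules agree, for all sites $x$, on $\mu$-almost-every configuration. *)

(* Defs.v *)
From HB Require Import structures.
From mathcomp Require Import all_boot all_order all_algebra.
From mathcomp Require Import all_classical all_reals all_analysis.

Set Implicit Arguments.
Unset Strict Implicit.
Unset Printing Implicit Defensive.

Import Order.TTheory GRing.Theory Num.Theory.
Local Open Scope classical_set_scope.
Local Open Scope ring_scope.

(* An alias of ['rV[int]_d], so that the lattice can carry the discrete
   sigma-algebra. *)
Definition site (d : nat) := 'rV[int]_d.

HB.instance Definition _ (d : nat) := GRing.Zmodule.on (site d).
HB.instance Definition _ (d : nat) := isPointed.Build (site d) 0.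
HB.instance Definition _ (d : nat) :=
  @isMeasurable.Build default_measure_display (site d) discrete_measurable
    discrete_measurable0 discrete_measurableC discrete_measurableU.

Definition cylinders (d : nat) : set (set (site d -> bool)) :=
  [set [set g | g x = b] | x in [set: site d] & b in [set: bool]].

(* The space {0,1}^(Z^d) with its product sigma-algebra. *)
Definition config (d : nat) := g_sigma_algebraType (@cylinders d).

(* The action of T^z on configurations; on sites, T^z is [x |-> x + z]. *)
Definition translate (d : nat) (z : site d) (g : config d) : config d :=
  fun y => g (y - z).

Section process.
Context {d : nat} {R : realType} (mu : probability (config d) R).

Definition translation_invariant : Prop :=
  forall (z : site d) (A : set (config d)), measurable A ->
    mu (translate z @^-1` A) = mu A.

Definition ergodic : Prop :=
  forall A : set (config d), measurable A ->
    (forall z : site d, translate z @^-1` A = A) -> mu A = 0%E \/ mu A = 1%E.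

Definition origin_occupied : set (config d) := [set g | g 0 = true].

Definition density : R := fine (mu origin_occupied).

(* The conditional law mu^* given that the origin is occupied; it is only
   meaningful when the density is nonzero. *)
Definition conditional_law (A : set (config d)) : \bar R :=
  (mu (A `&` origin_occupied) * (density^-1)%:E)%E.

(* [Phi g x = None] means that the rule is undefined there. *)
Record balanced_allocation_rule (Phi : config d -> site d -> option (site d)) :
    Prop := BalancedAllocationRule {
  allocation_measurable :
    forall x y : site d, measurable [set g : config d | Phi g x = Some y] ;
  allocation_defined : {ae mu, forall g : config d, forall x, isSome (Phi g x)} ;
  allocation_balanced : {ae mu, forall g : config d, forall y : site d,
    counting [set x | Phi g x = Some y] = (density^-1 * (g y)%:R)%:E } ;
  allocation_invariant : forall (g : config d) (x y z : site d),
    Phi g x = Some y -> Phi (translate z g) (x + z) = Some (y + z) }.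

End process.

Section extra_head.
Context {d : nat} {R : realType} (mu : probability (config d) R).
Context {d' : measure_display} {Omega : measurableType d'}.
Context (P : probability Omega R) (Gamma : {RV P >-> config d}).

Definition extra_head_scheme (X : Omega -> site d) : Prop :=
  measurable_fun [set: Omega] X /\
  forall A : set (config d), measurable A ->
    pushforward P (fun w => translate (- X w) (Gamma w)) A =
    conditional_law mu A.

Definition nonrandomized (X : Omega -> site d) : Prop :=
  exists F : {mfun config d >-> site d}, {ae P, forall w, X w = F (Gamma w)}.

(* The almost sure equality [X = Phi_Gamma(0)]. *)
Definition allocates_origin_to
    (Phi : config d -> site d -> option (site d)) (X : Omega -> site d) : Prop :=
  {ae P, forall w, Phi (Gamma w) 0 = Some (X w)}.

End extra_head.

(* Main.v *)
Require Import Defs.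
From HB Require Import structures.
From mathcomp Require Import all_boot all_order all_algebra.
From mathcomp Require Import all_classical all_reals all_analysis.
From mathcomp Require Import measurable_realfun.

Set Implicit Arguments.
Unset Strict Implicit.
Unset Printing Implicit Defensive.

Import Order.TTheory GRing.Theory Num.Theory.
Import numFieldNormedType.Exports.
Local Open Scope classical_set_scope.
Local Open Scope ring_scope.

(** The heart of the argument is a mass-transport identity.  If [Phi] is any
measurable translation-covariant partial map, then, for every measurable [A],
the integral over [A] of the number of sites allocated to the origin equals
the probability that [Phi] is defined at the origin and that the configuration
seen from [Phi_Gamma(0)] lies in [A] (lemma [mass_transport]).  To see this,
split both sides over the countably many sites: by covariance, translation by
[- y] maps the event [Phi_Gamma(0) = y], with the configuration seen from [y] in
[A], to the event [Phi_Gamma(-y) = 0], with the configuration itself in [A],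
and [mu] is translation-invariant.

On the other hand [mu^*] has density [p^-1 * g(0)] with respect to [mu]
(lemma [integral_conditional_density]).  If [Phi] is balanced, the number of
sites allocated to the origin is almost surely this density, so the
configuration seen from [Phi_Gamma(0)] has law [mu^*].

Conversely, if [X = F(Gamma)] almost surely, covariance forces [Phi_g(x) =
F(T^(-x) g) + x] almost everywhere, and this formula does define a covariant
rule. By mass transport and the extra head property, the number of sites
allocated to the origin has the same, finite, integrals over all measurable
sets as [p^-1 * g(0)], hence agrees with it almost everywhere. Translating,
and using that there are countably many sites, this gives the balance
condition at all sites. Uniqueness is the same principle: two rules which
agree at the origin almost surely agree, by covariance and countability, at
all sites. *)

(** * Sites, translations and cardinalities *)

(** An injective numbering of the sites, used to turn countable families
indexed by sites into sequences. *)
Definition site_code (d : nat) (x : site d) : nat := pickle (x : 'rV[int]_d).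

Lemma site_code_inj (d : nat) : injective (@site_code d).
Proof. exact: (pcan_inj (@pickleK _)). Qed.

Lemma countable_site (d : nat) : countable [set: site d].
Proof.
by apply/pcard_injP; exists (@site_code d) => x y _ _ /site_code_inj.
Qed.

Lemma translateK (d : nat) (z : site d) :
  cancel (@translate d z) (translate (- z)).
Proof. by move=> g; apply/funext => y; rewrite /translate opprK addrK. Qed.

Lemma translate0 (d : nat) (g : config d) : translate 0 g = g.
Proof. by apply/funext => y; rewrite /translate subr0. Qed.

Lemma counting_card_eq (R : realType) (T U : choiceType) (A : set T)
    (B : set U) : (A #= B)%card -> counting A = counting B :> \bar R.
Proof.
move=> AB; rewrite /counting (eq_finite_set AB).
case: ifPn => // /asboolP -[n Bn].
by rewrite (card_fset_set Bn) (card_fset_set (card_eq_trans AB Bn)).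
Qed.

Lemma counting_image (R : realType) (T U : choiceType) (f : T -> U)
    (A : set T) : injective f -> counting (f @` A) = counting A :> \bar R.
Proof.
by move=> f_inj; apply: counting_card_eq; apply: inj_card_eq => x y _ _ /f_inj.
Qed.

(** * Almost everywhere statements *)

Section almost_everywhere_lemmas.
Context {R : realType}.

Lemma ae_preimage (d1 d2 : measure_display) (T : measurableType d1)
    (U : measurableType d2) (mu : {measure set T -> \bar R})
    (nu : {measure set U -> \bar R}) (f : T -> U) (Q : U -> Prop) :
  measurable_fun [set: T] f ->
  (forall A, measurable A -> mu (f @^-1` A) = nu A) ->
  {ae nu, forall u, Q u} -> {ae mu, forall t, Q (f t)}.
Proof.
move=> mf fE [N [mN N0 QN]]; exists (f @^-1` N); split.
- by rewrite -[X in measurable X]setTI; exact: mf.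
- by rewrite fE.
- by move=> t; exact: QN.
Qed.

(** The converse needs [Q] to be measurable: a null set containing the preimage
of the complement of [Q] need not be the preimage of a measurable set. *)
Lemma ae_of_preimage (d1 d2 : measure_display) (T : measurableType d1)
    (U : measurableType d2) (mu : {measure set T -> \bar R})
    (nu : {measure set U -> \bar R}) (f : T -> U) (Q : set U) :
  measurable_fun [set: T] f ->
  (forall A, measurable A -> mu (f @^-1` A) = nu A) ->
  measurable Q -> {ae mu, forall t, Q (f t)} -> {ae nu, forall u, Q u}.
Proof.
move=> mf fE mQ aeQ; apply/negligibleP; first exact: measurableC.
transitivity (mu (f @^-1` ~` Q)); first by rewrite fE//; exact: measurableC.
apply: measure_negligible; last exact: aeQ.
by rewrite -[X in measurable X]setTI; apply: mf => //; exact: measurableC.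
Qed.

Lemma measurable_EFin_indic (d1 : measure_display) (T : measurableType d1)
    (D A : set T) :
  measurable A -> measurable_fun D (EFin \o (\1_A : T -> R)).
Proof. by move=> mA; apply/measurable_EFinP; exact: measurable_indic. Qed.

Lemma ae_eq_measure (d1 : measure_display) (T : measurableType d1)
    (mu : {measure set T -> \bar R}) (A B : set T) :
  measurable A -> measurable B -> {ae mu, forall t, A t <-> B t} ->
  mu A = mu B.
Proof.
move=> mA mB AB; rewrite -(setIT A) -(setIT B) -!integral_indic//.
apply: ge0_ae_eq_integral => //; try exact: measurable_EFin_indic.
apply: filterS AB => t ABt _; congr EFin.
rewrite !indicE; congr (nat_of_bool _)%:R.
by apply/idP/idP; rewrite !inE => /ABt.
Qed.

Lemma ae_forall_site (d1 : measure_display) (T : measurableType d1)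
    (mu : {measure set T -> \bar R}) (d : nat) (Q : site d -> T -> Prop) :
  (forall x, {ae mu, forall t, Q x t}) -> {ae mu, forall t, forall x, Q x t}.
Proof.
move=> aeQ.
have : {ae mu, forall t, forall n x, site_code x = n -> Q x t}.
  apply: ae_foralln => n.
  have [[y yn]|no] := pselect (exists y : site d, site_code y = n).
    by apply: filterS (aeQ y) => t Qt x; rewrite -yn => /site_code_inj ->.
  by apply: aeW => t x xn; case: no; exists x.
by apply: filterS => t Qt x; exact: Qt erefl.
Qed.

End almost_everywhere_lemmas.

(** * Measurability in the lattice *)

Section measurability_lemmas.
Context {d : nat} {d1 : measure_display} {T : measurableType d1}.

Lemma measurable_bigcup_site (E : site d -> set T) :
  (forall x, measurable (E x)) -> measurable [set t | exists x, E x t].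
Proof.
move=> mE; rewrite (_ : [set t | _] = \bigcup_x E x).
  exact: (countable_bigcupT_measurable (@countable_site d)).
by apply/seteqP; split => t [x]; [exists x|move=> _; exists x].
Qed.

Lemma measurable_fun_site (f : T -> site d) :
  (forall x, measurable [set t | f t = x]) -> measurable_fun [set: T] f.
Proof.
move=> mf _ Y _; rewrite setTI.
rewrite (_ : _ @^-1` _ = [set t | exists x, (Y x /\ f t = x)]); last first.
  apply/seteqP; split => [t Yt|t [x [Yx fx]]]; first by exists (f t).
  by rewrite /= fx.
apply: (@measurable_bigcup_site (fun x t => Y x /\ f t = x)) => x.
have [Yx|nYx] := pselect (Y x).
  rewrite (_ : (fun t => _) = [set t | f t = x]); first exact: mf.
  by apply/seteqP; split => [t []|t].
rewrite (_ : (fun t => _) = set0); first exact: measurable0.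
by apply/seteqP; split => [t []|t].
Qed.

Lemma measurable_translate (z : site d) :
  measurable_fun [set: config d] (translate z).
Proof.
apply: (@measurability _ _ (config d) (config d) _ _ (@cylinders d)) => //.
move=> _ [_ [x _ [b _ <-]] <-].
rewrite setTI; apply: sub_sigma_algebra.
by exists (x - z) => //; exists b.
Qed.

(** The configuration seen from a random site is a random configuration. *)
Lemma measurable_translate_by (X : T -> site d) (G : T -> config d) :
  measurable_fun [set: T] X -> measurable_fun [set: T] G ->
  measurable_fun [set: T] (fun t => translate (- X t) (G t)).
Proof.
move=> mX mG _ A mA; rewrite setTI.
rewrite (_ : _ @^-1` _ =
    [set t | exists x, X t = x /\ A (translate (- x) (G t))]); last first.
  by apply/seteqP; split => [t At|t [x [<-]]//]; exists (X t).
apply: (@measurable_bigcup_site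
  (fun x t => X t = x /\ A (translate (- x) (G t)))) => x.
apply: (measurableI [set t | X t = x]).
  by rewrite -[X in measurable X]setTI; exact: (mX _ [set x]).
rewrite -[X in measurable X]setTI.
apply: (measurableT_comp (measurable_translate (- x)) mG) => //.
Qed.

End measurability_lemmas.

(** * The mass-transport identity *)

Section mass_transport.
Context {d : nat} {R : realType} (mu : probability (config d) R).
Variable Phi : config d -> site d -> option (site d).
Hypothesis mPhi : forall x y, measurable [set g : config d | Phi g x = Some y].

(** The event that some site with code [n] is allocated to the origin; for an
injective code [c] there is at most one site to consider. *)
Let E (c : site d -> nat) (n : nat) : set (config d) :=
  [set g | exists x, Phi g x = Some 0 /\ c x = n].

Let mE (c : site d -> nat) n : measurable (E c n).
Proof.
apply: (@measurable_bigcup_site _ _ _ (fun x g => Phi g x = Some 0 /\ c x = n)).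
move=> x; have [cxn|cxn] := eqVneq (c x) n.
  rewrite (_ : (fun g => _) = [set g | Phi g x = Some 0]); first exact: mPhi.
  by apply/seteqP; split => [g []|g].
rewrite (_ : (fun g => _) = set0); first exact: measurable0.
by apply/seteqP; split => [g [_ /eqP]|g//]; rewrite (negbTE cxn).
Qed.

Let countingE (c : site d -> nat) : injective c -> forall g,
  counting [set x | Phi g x = Some 0] =
  (\sum_(n <oo) (\1_(E c n) g)%:E)%E :> \bar R.
Proof.
move=> c_inj g; rewrite -(counting_image _ _ c_inj) counting_dirac.
apply: eq_eseriesr => n _; congr EFin; rewrite /dirac !indicE.
congr (nat_of_bool _)%:R.
apply/idP/idP; rewrite !inE; first by move=> [x]; exists x.
by move=> [x []]; exists x.
Qed.

Lemma measurable_counting_preimage :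
  measurable_fun [set: config d]
    (fun g => counting [set x | Phi g x = Some 0] : \bar R).
Proof.
rewrite (funext (countingE (@site_code_inj d))).
apply: ge0_emeasurable_sum => [k g _ _|k _].
  by rewrite lee_fin.
exact: measurable_EFin_indic.
Qed.

Hypothesis Phi_inv : forall (g : config d) (x y z : site d),
  Phi g x = Some y -> Phi (translate z g) (x + z) = Some (y + z).

(** The expected number of sites allocated to the origin, on the event [A], is
the probability that the origin is allocated to a site from which the
configuration looks like an element of [A]. *)
Lemma mass_transport (A : set (config d)) :
  translation_invariant mu -> measurable A ->
  (\int[mu]_(g in A) counting [set x | Phi g x = Some 0%R])%E =
  mu [set g | exists y, Phi g 0 = Some y /\ A (translate (- y) g)].
Proof.
move=> hinv mA.
(* The summand for a target [y] on the right corresponds to the summand for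
   the source [- y] on the left, so sources are numbered by their opposites. *)
pose c (x : site d) := site_code (- x).
have c_inj : injective c by move=> x y /site_code_inj /oppr_inj.
pose B y := [set g | Phi g 0 = Some y /\ A (translate (- y) g)].
have mB y : measurable (B y).
  apply: (measurableI [set g | Phi g 0 = Some y]) => //.
  by rewrite -[X in measurable X]setTI; exact: measurable_translate.
pose Bn n := [set g | exists y, B y g /\ site_code y = n].
have BnE y : Bn (site_code y) = B y.
  by apply/seteqP; split => [g [x [Bx /site_code_inj <-]]//|g]; exists y.
have Bn0 n : ~ (exists y : site d, site_code y = n) -> Bn n = set0.
  by move=> no; apply/seteqP; split => // g [x [_ xn]]; case: no; exists x.
have mBn n : measurable (Bn n).
  have [[y <-]|/Bn0->//] := pselect (exists y : site d, site_code y = n).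
  by rewrite BnE.
transitivity (\sum_(n <oo) mu (E c n `&` A))%E.
  under eq_integral do rewrite (countingE c_inj).
  rewrite integral_nneseries//.
  - by apply: eq_eseriesr => n _; exact: integral_indic.
  - by move=> n; apply: measurable_funTS; exact: measurable_EFin_indic.
rewrite (_ : [set g | _] = \bigcup_n Bn n); last first.
  apply/seteqP; split => [g [y ?]|g [n _ [y [? _]]]]; last by exists y.
  by exists (site_code y) => //; exists y.
rewrite measure_semi_bigcup//; first last.
- exact: bigcupT_measurable.
- apply/trivIsetP => i j _ _; apply: contraNeq => /set0P[g].
  by move=> [[y [[Py _] <-]] [z [[Pz _] <-]]]; move: Pz; rewrite Py => -[->].
apply: eq_eseriesr => n _.
have [[y yn]|no] := pselect (exists y : site d, site_code y = n); last first.
  rewrite (Bn0 n no) (_ : E c n = set0) ?set0I//.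
  by apply/seteqP; split => // g [x [_ xn]]; case: no; exists (- x).
rewrite -(hinv (- y)); last exact: measurableI.
congr (mu _); rewrite -yn BnE; apply/seteqP; split => g.
- move=> [[x [Px /site_code_inj xy]] Ag]; split => //.
  have := Phi_inv y Px.
  by rewrite -{1}[y in translate y _]opprK translateK -xy addrN add0r.
- move=> [Py Ag]; split => //; exists (- y); split; last by rewrite /c opprK.
  by have := Phi_inv (- y) Py; rewrite add0r subrr.
Qed.

End mass_transport.

(** * The density of the conditional law *)

Section density_of_conditional_law.
Context {d : nat} {R : realType} (mu : probability (config d) R).

Lemma measurable_occupied (y : site d) :
  measurable [set g : config d | g y = true].
Proof. by apply: sub_sigma_algebra; exists y => //; exists true. Qed.

Let occupied_indicE (g : config d) :
  ((density mu)^-1 * (g 0)%:R)%:E =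
  ((density mu)^-1%:E * (\1_(@origin_occupied d) g)%:E)%E.
Proof.
rewrite -EFinM indicE; congr (_ * (nat_of_bool _)%:R)%:E.
by apply/idP/idP; rewrite inE.
Qed.

Lemma density_ge0 : 0 <= density mu.
Proof. exact: fine_ge0. Qed.

Lemma measurable_conditional_density :
  measurable_fun [set: config d] (fun g => ((density mu)^-1 * (g 0)%:R)%:E).
Proof.
rewrite (funext occupied_indicE).
apply: measurable_funeM; apply: measurable_EFin_indic.
exact: measurable_occupied.
Qed.

Lemma integral_conditional_density (A : set (config d)) : measurable A ->
  (\int[mu]_(g in A) ((density mu)^-1 * (g 0%R)%:R)%:E)%E =
  conditional_law mu A.
Proof.
move=> mA; under eq_integral do rewrite occupied_indicE.
have mO := measurable_occupied 0.
rewrite ge0_integralZl//; last first.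
- by rewrite lee_fin invr_ge0 density_ge0.
- exact: measurable_EFin_indic.
by rewrite integral_indic// /conditional_law muleC setIC.
Qed.

End density_of_conditional_law.

(** * Allocation rules and extra head schemes *)

Section allocation_and_extra_head.
Context {d : nat} {R : realType} (mu : probability (config d) R).
Hypothesis hinv : translation_invariant mu.

(** Seen from the site to which a balanced rule allocates the origin, the
configuration has the conditional law. *)
Lemma allocation_transport_law (Phi : config d -> site d -> option (site d))
    (A : set (config d)) :
  balanced_allocation_rule mu Phi -> measurable A ->
  mu [set g | exists y, Phi g 0 = Some y /\ A (translate (- y) g)] =
  conditional_law mu A.
Proof.
move=> [mPhi _ balPhi invPhi] mA.
rewrite -mass_transport// -integral_conditional_density//.
apply: ge0_ae_eq_integral => //.
- by apply: measurable_funTS; exact: measurable_counting_preimage.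
- by apply: measurable_funTS; exact: measurable_conditional_density.
- by move=> g _; rewrite lee_fin mulr_ge0// invr_ge0 density_ge0.
- by apply: filterS balPhi => g + _; exact.
Qed.

(** The only translation-covariant rule that allocates the origin to [F g] in
the configuration [g]; it is defined everywhere. *)
Definition allocation_of (F : config d -> site d) :
    config d -> site d -> option (site d) :=
  fun g x => Some (F (translate (- x) g) + x).

(** If translating the origin to [F g] turns [mu] into the conditional law, then
[allocation_of F] is balanced. *)
Lemma allocation_of_balanced (F : config d -> site d) :
  measurable_fun [set: config d] F ->
  (forall A, measurable A ->
     mu ((fun g => translate (- F g) g) @^-1` A) = conditional_law mu A) ->
  balanced_allocation_rule mu (allocation_of F).
Proof.
move=> mF lawF.
have mPhi x y : measurable [set g : config d | allocation_of F g x = Some y].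
  rewrite (_ : [set g | _] = (F \o translate (- x)) @^-1` [set y - x]).
    rewrite -[X in measurable X]setTI.
    by apply: (measurableT_comp mF (measurable_translate _)).
  apply/seteqP; split => g /=; first by move=> [<-]; rewrite addrK.
  by rewrite /allocation_of => ->; rewrite subrK.
have invPhi (g : config d) (x y z : site d) : allocation_of F g x = Some y ->
    allocation_of F (translate z g) (x + z) = Some (y + z).
  move=> [<-]; rewrite /allocation_of addrA; congr (Some (F _ + _ + _)).
  apply/funext => u; rewrite /translate; congr (g _).
  by rewrite !opprK addrA addrK.
have transport A : measurable A ->
    (\int[mu]_(g in A) counting [set x | allocation_of F g x = Some 0%R])%E =
    conditional_law mu A.
  move=> mA; rewrite mass_transport// -lawF//; congr (mu _).
  apply/seteqP; split => g /=; rewrite /allocation_of oppr0 translate0 addr0.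
    by move=> [y [[<-]]].
  by exists (F g).
have mN := @measurable_counting_preimage d R _ mPhi.
have balanced0 : {ae mu, forall g,
    counting [set x | allocation_of F g x = Some 0] =
    ((density mu)^-1 * (g 0)%:R)%:E}.
  have : ae_eq mu setT
      (fun g => counting [set x | allocation_of F g x = Some 0])
      (fun g => ((density mu)^-1 * (g 0)%:R)%:E).
    apply: integral_ae_eq => //.
    (* The total integral is the mass of [mu^*], which is finite. *)
    - apply/integrableP; split=> //.
      under eq_integral do rewrite gee0_abs//.
      rewrite transport// /conditional_law setTI.
      rewrite lte_mul_pinfty ?ltry//.
      by rewrite ge0_fin_numE// (le_lt_trans (probability_le1 _ _)) ?ltry//;
        exact: measurable_occupied.
    - exact: measurable_conditional_density.
    - move=> A _ mA; rewrite transport//.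
      by rewrite integral_conditional_density.
  by apply: filterS => g; exact.
split=> //; first exact: aeW.
apply: ae_forall_site => y.
have := ae_preimage (measurable_translate (- y)) (@hinv (- y)) balanced0.
apply: filterS => g; rewrite {2}/translate opprK add0r => <-.
(* The sites allocated to [y] in [g] are, up to the shift by [- y], those
   allocated to the origin in [translate (- y) g]. *)
rewrite -[LHS](counting_image _ _ (@addIr _ (- y))); congr counting.
apply/seteqP; split => [_ [x /invPhi Px <-]|x /invPhi Px] /=.
  by rewrite Px subrr.
exists (x + y); last by rewrite addrK.
have := Px y; rewrite add0r -{1}[y in translate y _]opprK.
by rewrite translateK.
Qed.

Lemma allocation_unique (Phi Phi' : config d -> site d -> option (site d)) :
  balanced_allocation_rule mu Phi -> balanced_allocation_rule mu Phi' ->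
  {ae mu, forall g, exists y, Phi g 0 = Some y /\ Phi' g 0 = Some y} ->
  {ae mu, forall g, forall x, Phi g x = Phi' g x}.
Proof.
move=> [_ _ _ invPhi] [_ _ _ invPhi'] agree0; apply: ae_forall_site => x.
have := ae_preimage (measurable_translate (- x)) (@hinv (- x)) agree0.
apply: filterS => g [y []] /invPhi - /(_ x) + /invPhi' - /(_ x).
by rewrite -[x in translate x _]opprK translateK add0r => -> ->.
Qed.

End allocation_and_extra_head.

Theorem proposition7 (d : nat) (R : realType) (mu : probability (config d) R)
    (d' : measure_display) (Omega : measurableType d') (P : probability Omega R)
    (Gamma : {RV P >-> config d})
    (hd : (1 <= d)%N)
    (hinv : translation_invariant mu)
    (herg : ergodic mu)
    (hlaw : forall A : set (config d), measurable A ->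
       distribution P Gamma A = mu A)
    (hp : 0 < density mu < 1)
    (hpint : exists m : int, density mu = (m%:~R)^-1) :
  (forall Phi : config d -> site d -> option (site d),
     balanced_allocation_rule mu Phi ->
     let X := fun w => odflt 0 (Phi (Gamma w) 0) in
     allocates_origin_to Gamma Phi X /\
     extra_head_scheme mu Gamma X /\ nonrandomized Gamma X) /\
  (forall X : Omega -> site d,
     extra_head_scheme mu Gamma X -> nonrandomized Gamma X ->
     (exists Phi : config d -> site d -> option (site d),
        balanced_allocation_rule mu Phi /\ allocates_origin_to Gamma Phi X) /\
     (forall Phi Phi' : config d -> site d -> option (site d),
        balanced_allocation_rule mu Phi -> allocates_origin_to Gamma Phi X ->
        balanced_allocation_rule mu Phi' -> allocates_origin_to Gamma Phi' X ->
        {ae mu, forall g : config d, forall x : site d, Phi g x = Phi' g x})).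
Proof.
have origin_law (A : set (config d)) : measurable A -> P (Gamma @^-1` A) = mu A.
  exact: hlaw.
have mGamma : measurable_fun [set: Omega] Gamma by [].
split.
  move=> Phi bPhi X; have [mPhi defPhi _ _] := bPhi.
  pose F (g : config d) := odflt 0 (Phi g 0).
  have mdef : measurable [set g : config d | exists y, Phi g 0 = Some y].
    apply: (@measurable_bigcup_site _ _ _ (fun y g => Phi g 0 = Some y)) => y.
    exact: mPhi.
  have mF : measurable_fun [set: config d] F.
    apply: measurable_fun_site => y.
    (* The default value of [odflt] contributes to the fibre over [0] only. *)
    rewrite (_ : [set g | _] = [set g | Phi g 0 = Some y] `|`
        (~` [set g | exists y, Phi g 0 = Some y] `&` [set _ | y = 0])).
      apply: measurableU => //; apply: measurableI; first exact: measurableC.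
      have [->|/eqP y0] := eqVneq y 0.
        by rewrite (_ : [set _ | _] = setT)//; apply/seteqP; split.
      by rewrite (_ : [set _ | _] = set0)//; apply/seteqP; split.
    apply/seteqP; split => g; rewrite /F /=; last first.
      move=> [->//|[Pg ->]]; case E : (Phi g 0) => [z|]//.
      by case: Pg; exists z.
    case: (Phi g 0) => [z|] /= <-; first by left.
    by right; split => // -[].
  have mX : measurable_fun [set: Omega] X.
    exact: (measurableT_comp mF mGamma).
  split; [|split; [split=> // A mA|]].
  - have def0 : {ae mu, forall g, Phi g 0 = Some (F g)}.
      by apply: filterS defPhi => g /(_ 0); rewrite /F; case: (Phi g 0).
    exact: (ae_preimage mGamma origin_law def0).
  - have mT := measurable_translate_by mF (@measurable_id _ (config d) setT).
    rewrite -(allocation_transport_law hinv bPhi mA).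
    transitivity (mu ((fun g => translate (- F g) g) @^-1` A)).
      rewrite -origin_law//.
      by rewrite -[X in measurable X]setTI; exact: mT.
    apply: ae_eq_measure.
    + by rewrite -[X in measurable X]setTI; exact: mT.
    + apply: (@measurable_bigcup_site _ _ _
        (fun y g => Phi g 0 = Some y /\ A (translate (- y) g))) => y.
      apply: (measurableI [set g | Phi g 0 = Some y]) => //.
      by rewrite -[X in measurable X]setTI; exact: measurable_translate.
    + apply: filterS defPhi => g /(_ 0); rewrite /F /=.
      case: (Phi g 0) => //= y _; split; first by exists y.
      by move=> [z [[->]]].
  - pose Fm : {mfun config d >-> site d} :=
      HB.pack F (isMeasurableFun.Build _ _ _ _ F mF).
    by exists Fm; exact: aeW.
move=> X [mX lawX] [F XF].
have mF : measurable_fun [set: config d] F by [].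
split.
  exists (allocation_of F); split; last first.
    by apply: filterS XF => w ->; rewrite /allocation_of oppr0 translate0 addr0.
  apply: allocation_of_balanced => // A mA.
  have mT := measurable_translate_by mF (@measurable_id _ (config d) setT).
  have mTX := measurable_translate_by mX mGamma.
  have mTA : measurable ((fun g => translate (- F g) g) @^-1` A).
    by rewrite -[X in measurable X]setTI; exact: mT.
  rewrite -origin_law// -lawX//; apply: ae_eq_measure.
  - by rewrite -[X in measurable X]setTI; exact: mGamma.
  - by rewrite -[X in measurable X]setTI; exact: mTX.
  - by apply: filterS XF => w /= ->.
move=> Phi Phi' bPhi PhiX bPhi' PhiX'.
apply: allocation_unique => //.
apply: (ae_of_preimage mGamma origin_law).
  apply: (@measurable_bigcup_site _ _ _
    (fun y g => Phi g 0 = Some y /\ Phi' g 0 = Some y)) => y.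
  apply: (measurableI [set g | Phi g 0 = Some y]).
    exact: (allocation_measurable bPhi).
  exact: (allocation_measurable bPhi').
by apply: filterS2 PhiX PhiX' => w Pw Pw'; exists (X w).
Qed.
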